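(* Let $k\ge 2$. Over all probability vectors $\mathbf p=(p_0,\dots,p_{k-1})$ with $p_i>0$ for every $i$, the quantity $\overline C_{\mathbf p}$ has minimum value $\frac{3}{2\log k}$, achieved uniquely at $\mathbf p=\left(\frac1k,\dots,\frac1k\right)$. Moreover, for every such $\mathbf p$, $$C_{\mathbf p}\in\left[\frac{3}{2\psi_{\mathbf p}(2)},\frac{7}{4\psi_{\mathbf p}(2)}\right)\quad\text{and}\quad \widetilde C_{\mathbf p}\in\left[\frac{1}{\psi_{\mathbf p}(2)},\frac{2}{\psi_{\mathbf p}(2)}\right).$$
   Context: Constants (all logarithms are natural): $p_{\max}=\max_i p_i$; $\phi_{\mathbf p}(t)=\sum_{i=0}^{k-1}p_i^t$; $\psi_{\mathbf p}(t)=-\log\phi_{\mathbf p}(t)$; $\theta_{\mathbf p}>0$ is the unique number with $\psi_{\mathbf p}(\theta_{\mathbf p})=2\psi_{\mathbf p}(2)$, i.e. $\phi_{\mathbf p}(\theta_{\mathbf p})=\phi_{\mathbf p}(2)^2$. Define $$C_{\mathbf p}=\frac{3+\theta_{\mathbf p}}{4\psi_{\mathbf p}(2)},\qquad \widetilde C_{\mathbf p}=\frac1{\log(1/p_{\max})},\qquad \overline C_{\mathbf p}=\max(\widetilde C_{\mathbf p},C_{\mathbf p}).$$ *)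

(* Defs.v *)
From mathcomp Require Import all_boot all_order all_algebra.
From mathcomp Require Import all_classical all_reals all_analysis.
Set Implicit Arguments.
Unset Strict Implicit.
Unset Printing Implicit Defensive.
Import Order.TTheory GRing.Theory Num.Theory.
Local Open Scope classical_set_scope.
Local Open Scope ring_scope.

Definition pos_prob_vec (R : realType) (k : nat) (p : 'rV[R]_k) : Prop :=
  (forall i, 0 < p ord0 i) /\ \sum_(i < k) p ord0 i = 1.

Definition unif_vec (R : realType) (k : nat) : 'rV[R]_k :=
  const_mx (k%:R^-1).

(* The default value 0 of the iterated maximum is harmless: it is only used
   for vectors with positive entries and k >= 2. *)
Definition pmax (R : realType) (k : nat) (p : 'rV[R]_k) : R :=
  \big[Num.max/0]_(i < k) p ord0 i.

Definition phi (R : realType) (k : nat) (p : 'rV[R]_k) (t : R) : R :=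
  \sum_(i < k) (p ord0 i) `^ t.

Definition psi (R : realType) (k : nat) (p : 'rV[R]_k) (t : R) : R :=
  - ln (phi p t).

(* For k >= 2 and a positive probability vector p, psi p is continuous and
   strictly increasing from - ln k at 0 to +oo, and psi p 2 > 0, so exactly one
   positive t satisfies the condition and xget returns it. The default 0 is
   returned only if no such t exists. *)
Definition theta (R : realType) (k : nat) (p : 'rV[R]_k) : R :=
  xget 0 [set t : R | 0 < t /\ psi p t = 2 * psi p 2].

Definition C (R : realType) (k : nat) (p : 'rV[R]_k) : R :=
  (3 + theta p) / (4 * psi p 2).

Definition Ctilde (R : realType) (k : nat) (p : 'rV[R]_k) : R :=
  1 / ln (1 / pmax p).

Definition Cbar (R : realType) (k : nat) (p : 'rV[R]_k) : R :=
  Num.max (Ctilde p) (C p).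

(* Main.v *)
Require Import Defs.
From mathcomp Require Import all_boot all_order all_algebra.
From mathcomp Require Import all_classical all_reals all_analysis.
From mathcomp Require Import ring lra.
Import Order.TTheory GRing.Theory Num.Theory.
Import numFieldNormedType.Exports.
Local Open Scope ring_scope.

(** Everything reduces to comparing power sums of [p].

    Since [phi p] is continuous and strictly decreasing, the equation
    [phi p t = phi p 2 ^+ 2] that defines [theta p] can be located by evaluating
    [phi p] at integers.  Cauchy-Schwarz gives
    [phi p 2 ^+ 2 <= phi p 1 * phi p 3 = phi p 3], while
    [phi p 4 < phi p 2 ^+ 2] because the square of a sum of at least two
    positive terms strictly exceeds the sum of their squares.  Hence
    [3 <= theta p < 4] ([theta_itv]), which is the enclosure of [C p].
    Similarly [pmax p ^+ 2 < phi p 2 <= pmax p] ([sqr_pmax_lt_phi2],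
    [phi2_le_pmax]), and taking logarithms gives the enclosure of [Ctilde p].

    For the minimum, the variance identity
    [\sum_i (p_i - k^-1) ^+ 2 = phi p 2 - k^-1] ([variance_phi2]) shows
    [psi p 2 <= ln k], with equality only for the uniform vector.  Therefore
    [Cbar p >= C p >= 3 / (2 * psi p 2) >= 3 / (2 * ln k)], and equality
    throughout forces [p] to be uniform.  At the uniform vector
    [theta = 3], so [C] equals [3 / (2 * ln k)] there and exceeds
    [Ctilde = 1 / ln k]. *)

(** * Sums of positive terms *)

Lemma term_lt_sum {R : realType} {I : finType} (f : I -> R) (i : I) :
  (1 < #|I|)%N -> (forall j, 0 < f j) -> f i < \sum_j f j.
Proof.
move=> I_gt1 f_gt0; rewrite (bigD1 i) //= ltrDl.
have [j ji] : exists j, j != i.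
  by have := I_gt1; rewrite (cardD1 i) ltnS => /card_gt0P[j /andP[? _]]; exists j.
rewrite (bigD1 j) //= ltr_wpDr // sumr_ge0 // => l _; exact: ltW.
Qed.

(** * Power sums of a probability vector *)

Section PowerSums.
Context {R : realType} {k : nat} (p : 'rV[R]_k).
Hypotheses (k_ge2 : (2 <= k)%N) (pP : pos_prob_vec p).

Let p_gt0 i : 0 < p ord0 i.
Proof. by case: pP. Qed.

Let sum_p : \sum_(i < k) p ord0 i = 1.
Proof. by case: pP. Qed.

Let i0 : 'I_k := Ordinal (ltnW k_ge2).

Let has_ord : has xpredT (index_enum 'I_k).
Proof. by apply/hasP; exists i0; rewrite ?mem_index_enum. Qed.

Lemma prob_lt1 i : p ord0 i < 1.
Proof. by rewrite -sum_p; apply: term_lt_sum => //; rewrite card_ord. Qed.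

Lemma phi_natE (n : nat) : phi p n%:R = \sum_(i < k) p ord0 i ^+ n.
Proof. by apply: eq_bigr => i _; rewrite powR_mulrn // ltW. Qed.

Lemma phi_gt0 t : 0 < phi p t.
Proof.
have := @term_lt_sum R 'I_k (fun i => p ord0 i `^ t) i0.
rewrite card_ord => /(_ k_ge2 (fun i => powR_gt0 t (p_gt0 i))).
exact/lt_trans/powR_gt0.
Qed.

Lemma phi_decreasing : {mono phi p : s t /~ s < t}.
Proof.
apply: leW_nmono; apply: le_nmono => t s st.
apply: ltr_sum => // i _; rewrite /powR gt_eqF // ltr_expR.
by rewrite ltr_nM2r // ln_lt0 // p_gt0 prob_lt1.
Qed.

Lemma phi_continuous : continuous (phi p).
Proof.
move=> t; apply: cvg_big => [|i _]; first exact: add_continuous.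
rewrite /powR gt_eqF //; apply: continuous_comp; last exact: continuous_expR.
exact: mulrr_continuous.
Qed.

(** Cauchy-Schwarz for the weights [p], in the form of a nonnegative
    variance: [\sum_i p_i * (p_i - phi p 2) ^+ 2 = phi p 3 - phi p 2 ^+ 2]. *)
Lemma sqr_phi2_le_phi3 : phi p 2 ^+ 2 <= phi p 3.
Proof.
rewrite -subr_ge0.
suff -> : phi p 3 - phi p 2 ^+ 2
        = \sum_(i < k) p ord0 i * (p ord0 i - phi p 2) ^+ 2.
  by apply: sumr_ge0 => i _; rewrite mulr_ge0 ?sqr_ge0 // ltW.
set s := phi p 2.
transitivity (phi p 3 - 2 * s * phi p 2 + s ^+ 2 * \sum_(i < k) p ord0 i).
  by rewrite sum_p -/s; ring.
rewrite (phi_natE 3) (phi_natE 2); clearbody s.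
rewrite !mulr_sumr -sumrB -big_split /=; apply: eq_bigr => i _; ring.
Qed.

Lemma sqr_prob_lt_phi2 i : p ord0 i ^+ 2 < phi p 2.
Proof.
rewrite (phi_natE 2).
apply: (@term_lt_sum R 'I_k (fun i => p ord0 i ^+ 2)) => [|j].
  by rewrite card_ord.
exact: exprn_gt0.
Qed.

(** Termwise: each factor [p_i ^+ 2] of [p_i ^+ 4] is smaller than the full
    sum [phi p 2]. *)
Lemma phi4_lt_sqr_phi2 : phi p 4 < phi p 2 ^+ 2.
Proof.
rewrite (phi_natE 4) expr2 {1}(phi_natE 2) mulr_suml.
apply: ltr_sum => // i _; rewrite -[4%N]/(2 + 2)%N exprD.
by rewrite ltr_pM2l ?exprn_gt0 // sqr_prob_lt_phi2.
Qed.

Lemma phi2_lt1 : phi p 2 < 1.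
Proof.
rewrite (phi_natE 2) -sum_p; apply: ltr_sum => // i _.
by rewrite expr2 gtr_pMl // prob_lt1.
Qed.

Lemma psi2_gt0 : 0 < psi p 2.
Proof. by rewrite /psi oppr_gt0 ln_lt0 // phi_gt0 phi2_lt1. Qed.

(** * Location of theta *)

Lemma psi_eq_double t : psi p t = 2 * psi p 2 <-> phi p t = phi p 2 ^+ 2.
Proof.
have -> : 2 * psi p 2 = - ln (phi p 2 ^+ 2).
  by rewrite /psi lnXn ?phi_gt0 // mulr2n; ring.
rewrite /psi; split => [/oppr_inj|->//].
by apply: ln_inj; rewrite posrE ?exprn_gt0 // phi_gt0.
Qed.

(** Monotonicity of [phi p] makes any root the chosen one, so [theta p] can be
    computed by exhibiting a root. *)
Lemma theta_unique t : 0 < t -> phi p t = phi p 2 ^+ 2 -> theta p = t.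
Proof.
move=> t_gt0 phit; apply: xget_unique => [|s [_ /psi_eq_double]].
  by split => //; apply/psi_eq_double.
move=> phis; have eq_phi : phi p s = phi p t by rewrite phit.
by case: (ltgtP s t) => //; rewrite -phi_decreasing eq_phi ltxx.
Qed.

(** The intermediate value theorem on [3, 4] both produces a root, so that the
    choice in [theta] is not vacuous, and locates it. *)
Lemma theta_itv : theta p \in `[3, 4[.
Proof.
have [t] : exists2 t, t \in `[3, 4] & phi p t = phi p 2 ^+ 2.
  apply: IVT; first by lra.
    exact/continuous_subspaceT/phi_continuous.
  by rewrite ge_min le_max sqr_phi2_le_phi3 (ltW phi4_lt_sqr_phi2) orbT.
rewrite !in_itv /= => /andP[t_ge3 _] phit.
rewrite (theta_unique _ _ phit); last by lra.
by rewrite t_ge3 -phi_decreasing phit phi4_lt_sqr_phi2.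
Qed.

Lemma C_itv : C p \in `[3 / (2 * psi p 2), 7 / (4 * psi p 2)[.
Proof.
have := theta_itv; rewrite !in_itv /= => /andP[theta_ge3 theta_lt4].
have psi_gt0 := psi2_gt0.
have -> : 3 / (2 * psi p 2) = 6 / (4 * psi p 2).
  by field; rewrite gt_eqF.
rewrite /C ler_pM2r ?ltr_pM2r ?invr_gt0 ?mulr_gt0 //.
by apply/andP; split; lra.
Qed.

(** * The largest entry *)

Lemma pmax_entry : exists i, pmax p = p ord0 i.
Proof.
have p_ge0 i : true -> 0 <= p ord0 i by rewrite ltW.
have [i _ pmaxE] := @eq_bigmax _ R _ 0 i0 xpredT (p ord0) isT p_ge0.
by exists i.
Qed.

Lemma sqr_pmax_lt_phi2 : pmax p ^+ 2 < phi p 2.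
Proof. by have [i ->] := pmax_entry; exact: sqr_prob_lt_phi2. Qed.

(** [phi p 2] is the [p]-weighted mean of the entries of [p]. *)
Lemma phi2_le_pmax : phi p 2 <= pmax p.
Proof.
rewrite (phi_natE 2) -[leRHS]mul1r -sum_p mulr_suml.
apply: ler_sum => i _; rewrite expr2 ler_pM2l //.
exact: (@le_bigmax _ R).
Qed.

Lemma Ctilde_itv : Ctilde p \in `[1 / psi p 2, 2 / psi p 2[.
Proof.
have [i pmaxE] := pmax_entry.
have pmax_gt0 : 0 < pmax p by rewrite pmaxE.
have ln_pmax_lt0 : ln (pmax p) < 0.
  by rewrite ln_lt0 // pmax_gt0 pmaxE prob_lt1.
have le_psi : - ln (pmax p) <= psi p 2.
  by rewrite lerN2 ler_ln ?posrE ?phi_gt0 // phi2_le_pmax.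
have psi_lt : psi p 2 < 2 * - ln (pmax p).
  rewrite mulrN ltrN2 mulr_natl -lnXn //.
  by rewrite ltr_ln ?posrE ?exprn_gt0 ?phi_gt0 // sqr_pmax_lt_phi2.
have psi_gt0 := psi2_gt0.
have ln_gt0 : 0 < - ln (pmax p) by rewrite oppr_gt0.
rewrite in_itv /= /Ctilde !div1r lnV ?posrE //; apply/andP; split.
  by rewrite lef_pV2.
by rewrite ltr_pdivlMr // mulrC ltr_pdivrMr.
Qed.

(** * Comparison with the uniform vector *)

Lemma variance_phi2 :
  \sum_(i < k) (p ord0 i - k%:R^-1) ^+ 2 = phi p 2 - k%:R^-1.
Proof.
have k_neq0 : k%:R != 0 :> R by rewrite pnatr_eq0 -lt0n ltnW.
transitivity (phi p 2
  - 2 * k%:R^-1 * \sum_(i < k) p ord0 i + \sum_(i < k) k%:R^-1 ^+ 2).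
  by rewrite (phi_natE 2) mulr_sumr -sumrB -big_split; apply: eq_bigr => i _ /=; ring.
rewrite sum_p sumr_const card_ord -mulr_natr.
by field.
Qed.

Lemma psi2_le_ln : psi p 2 <= ln k%:R.
Proof.
have k_gt0 : 0 < k%:R :> R by rewrite ltr0n ltnW.
rewrite -[leRHS]opprK -lnV ?posrE // lerN2.
rewrite ler_ln ?posrE ?invr_gt0 ?phi_gt0 // -subr_ge0 -variance_phi2.
by apply: sumr_ge0 => i _; exact: sqr_ge0.
Qed.

Lemma psi2_eq_ln : psi p 2 = ln k%:R -> p = unif_vec R k.
Proof.
have k_gt0 : 0 < k%:R :> R by rewrite ltr0n ltnW.
move=> psiE; have phiE : phi p 2 = k%:R^-1.
  apply: ln_inj; rewrite ?posrE ?invr_gt0 ?phi_gt0 //.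
  by rewrite lnV ?posrE // -psiE opprK.
have := variance_phi2; rewrite phiE subrr => var0.
apply/matrixP => i j; rewrite ord1 mxE; apply/eqP.
rewrite -subr_eq0 -sqrf_eq0; apply/eqP.
by apply: (psumr_eq0P _ var0) => // l _; exact: sqr_ge0.
Qed.

Lemma Cbar_ge_psi2 : 3 / (2 * psi p 2) <= Cbar p.
Proof.
have := C_itv; rewrite in_itv /= => /andP[C_ge _].
by rewrite le_max C_ge orbT.
Qed.

End PowerSums.

(** * The uniform vector *)

Section Uniform.
Context (R : realType) {k : nat}.
Hypothesis k_ge2 : (2 <= k)%N.

Let k_gt0 : 0 < k%:R :> R.
Proof. by rewrite ltr0n ltnW. Qed.

Lemma unif_pos_prob_vec : pos_prob_vec (unif_vec R k).
Proof.
split=> [i|]; first by rewrite mxE invr_gt0.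
under eq_bigr do rewrite mxE.
by rewrite sumr_const card_ord -[LHS]mulr_natr mulVf ?gt_eqF.
Qed.

Lemma unif_phi (n : nat) : phi (unif_vec R k) n.+1%:R = k%:R^-1 ^+ n.
Proof.
rewrite phi_natE; last exact: unif_pos_prob_vec.
under eq_bigr do rewrite mxE.
by rewrite sumr_const card_ord -[LHS]mulr_natr exprS mulrAC mulVf ?gt_eqF ?mul1r.
Qed.

Lemma unif_psi2 : psi (unif_vec R k) 2 = ln k%:R.
Proof. by rewrite /psi (unif_phi 1) expr1 lnV ?posrE // opprK. Qed.

Lemma unif_pmax : pmax (unif_vec R k) = k%:R^-1.
Proof.
by have [i ->] := pmax_entry _ k_ge2 unif_pos_prob_vec; rewrite mxE.
Qed.

Lemma unif_theta : theta (unif_vec R k) = 3.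
Proof.
apply: (theta_unique _ k_ge2 unif_pos_prob_vec) => //.
by rewrite (unif_phi 2) (unif_phi 1).
Qed.

Lemma unif_Cbar : Cbar (unif_vec R k) = 3 / (2 * ln k%:R).
Proof.
have ln_gt0 : 0 < ln k%:R :> R by rewrite ln_gt0 // ltr1n.
have CE : C (unif_vec R k) = 3 / (2 * ln k%:R).
  by rewrite /C unif_theta unif_psi2; field; rewrite gt_eqF.
rewrite /Cbar CE; apply/max_idPr.
rewrite /Ctilde unif_pmax !div1r invrK invfM mulrA.
by rewrite ler_peMl ?invr_ge0 ?ltW //; lra.
Qed.

End Uniform.

(** * Minimum of Cbar and enclosures of its two terms *)

Theorem proposition1p1 (R : realType) (k : nat) (hk : (2 <= k)%N) :
  [/\ pos_prob_vec (unif_vec R k),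
      Cbar (unif_vec R k) = 3 / (2 * ln k%:R),
      (forall p : 'rV[R]_k, pos_prob_vec p -> 3 / (2 * ln k%:R) <= Cbar p) &
      (forall p : 'rV[R]_k, pos_prob_vec p ->
         Cbar p = 3 / (2 * ln k%:R) -> p = unif_vec R k)]
  /\ (forall p : 'rV[R]_k, pos_prob_vec p ->
        (C p \in `[3 / (2 * psi p 2), (7 / (4 * psi p 2))[) /\
        (Ctilde p \in `[1 / psi p 2, (2 / psi p 2)[)).
Proof.
have ln_gt0 : 0 < ln k%:R :> R by rewrite ln_gt0 // ltr1n.
have bound (p : 'rV[R]_k) : pos_prob_vec p ->
    (3 / (2 * ln k%:R) <= 3 / (2 * psi p 2)) *
    ((3 / (2 * psi p 2) <= 3 / (2 * ln k%:R)) = (ln k%:R <= psi p 2)).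
  move=> pP; have psi_gt0 := psi2_gt0 _ hk pP.
  rewrite !ler_pM2l // !lef_pV2 ?posrE ?mulr_gt0 // !ler_pM2l //.
  by split=> //; exact: psi2_le_ln.
split; last by move=> p pP; split; [exact: C_itv | exact: Ctilde_itv].
split=> [||p pP|p pP CbarE].
- exact: unif_pos_prob_vec.
- exact: unif_Cbar.
- exact: le_trans (bound p pP).1 (Cbar_ge_psi2 _ hk pP).
apply: (psi2_eq_ln _ hk pP); apply: le_anti; rewrite psi2_le_ln //=.
by rewrite -(bound p pP).2 -CbarE Cbar_ge_psi2.
Qed.
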